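(* Let $\mathcal{A}_1=\mathbb{C}1\oplus\mathcal{A}_1^0$ and $\mathcal{A}_2=\mathbb{C}1\oplus\mathcal{A}_2^0$ be two augmented unital complex algebras equipped with triples of linear functionals $(\psi_i,\varphi_i,\omega_i)$ on $\mathcal{A}_i$ ($i=1,2$), where $\psi_i,\varphi_i$ are unital, $\omega_i$ is tracial and $\omega_1(1_{\mathcal{A}_1})=\omega_2(1_{\mathcal{A}_2})$. Let $(\psi,\varphi,\omega)=(\psi_1,\varphi_1,\omega_1)\circledast(\psi_2,\varphi_2,\omega_2)$ on $\mathcal{A}_1\star\mathcal{A}_2$. Assume $\psi_1=\delta_1$ and $\psi_2=\varphi_2$. Then for any $n\ge1$, $a_1,\dots,a_n\in\mathcal{A}_1^0$ and $b_0,\dots,b_n\in\mathcal{A}_2$, $$\varphi(b_0a_1b_1\cdots a_nb_n)=\varphi(a_1\cdots a_n)\,\varphi(b_0)\cdots\varphi(b_n)$$ and $$\omega(b_0a_1b_1\cdots a_nb_n)=\omega(a_1\cdots a_n)\,\varphi(b_1)\cdots\varphi(b_{n-1})\,\varphi(b_nb_0).$$ In other words, $(\mathcal{A}_1^0,\mathcal{A}_2)$ are cyclic-monotone independent with respect to $(\varphi,\omega)$.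
   Context: Here $\mathcal{A}_i$ is the unitization of an algebra $\mathcal{A}_i^0$ and $\delta_i:\mathcal{A}_i\to\mathbb{C}$ is $\delta_i(\lambda 1+a^0)=\lambda$ for $\lambda\in\mathbb{C}$, $a^0\in\mathcal{A}_i^0$. $\star$ is the free product of unital algebras with identification of units. Tracial: $\omega(ab)=\omega(ba)$. A sequence $(a_1,\dots,a_n)$ with $a_j\in\mathcal{A}_{i_j}$ is alternating if $i_1\ne i_2\ne\cdots\ne i_n$; cyclically alternating if moreover $i_n\ne i_1$ (so $n\ge2$); centered w.r.t. $\psi$ if $\psi(a_j)=0$ for all $j$. $(\psi_1,\varphi_1,\omega_1)\circledast(\psi_2,\varphi_2,\omega_2)=(\psi,\varphi,\omega)$ is the unique triple of linear functionals on $\mathcal{A}_1\star\mathcal{A}_2$ extending the given ones, with $\omega$ tracial, such that: for every alternating sequence in $\mathcal{A}_1\cup\mathcal{A}_2$ centered w.r.t. $\psi$, $\psi(a_1\cdots a_n)=0$ and $\varphi(a_1\cdots a_n)=\varphi(a_1)\cdots\varphi(a_n)$; and for every cyclically alternating sequence centered w.r.t. $\psi$, $\omega(a_1\cdots a_n)=\varphi(a_1)\cdots\varphi(a_n)$. Cyclic-monotone independence of $(\mathcal{A}_1^0,\mathcal{A}_2)$ w.r.t. $(\varphi,\omega)$ means precisely that the two displayed identities of the claim hold. *)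

(* Defs.v *)
(** The complex field is [R[i]], with [R : realType]. *)
From HB Require Import structures.
From mathcomp Require Import all_boot all_order all_algebra.
From mathcomp Require Import reals complex.

Set Implicit Arguments.
Unset Strict Implicit.
Unset Printing Implicit Defensive.

Import GRing.Theory.
Local Open Scope ring_scope.

(** [aug A] exhibits [A] as the unitization of the not necessarily unital
    algebra [aug_pred]: a subspace closed under products (hence an ideal) with
    [A = C 1 (+) aug_pred]. *)
Record augmentation (R : realType) (A : algType R[i]) := Augmentation {
  aug_pred :> {pred A};
  aug_submod_closed : submod_closed aug_pred;
  aug_mul_closed : GRing.mulr_2closed aug_pred;
  aug_ex : forall x : A, exists l : R[i], x - l%:A \in aug_pred;
  aug_direct : forall l : R[i], l%:A \in aug_pred -> l = 0
}.

Definition aug_delta (R : realType) (A : algType R[i]) (A0 : augmentation A)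
  (x : A) : R[i] := xchoose (aug_ex A0 x).

Lemma aug_deltaE (R : realType) (A : algType R[i]) (A0 : augmentation A)
  (l : R[i]) (a : A) : a \in A0 -> aug_delta A0 (l%:A + a) = l.
Proof.
move=> aA0; rewrite /aug_delta; set m := xchoose _.
have mP : l%:A + a - m%:A \in A0 := xchooseP (aug_ex A0 (l%:A + a)).
have [A00 lin] := aug_submod_closed A0.
apply/eqP; rewrite eq_sym -subr_eq0; apply/eqP/(@aug_direct _ _ A0).
have -> : (l - m)%:A = (-1) *: a + (l%:A + a - m%:A) :> A.
  by rewrite scaleN1r addrAC [_ + a]addrC addKr scalerBl.
exact: lin.
Qed.

(** The free product with identified units is the coproduct in the category of
    unital algebras. *)
Record free_product (R : realType) (A1 A2 : algType R[i]) := FreeProduct {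
  fp_alg :> algType R[i];
  fp_in1 : {lrmorphism A1 -> fp_alg};
  fp_in2 : {lrmorphism A2 -> fp_alg};
  fp_univ : forall (B : algType R[i])
      (f1 : {lrmorphism A1 -> B}) (f2 : {lrmorphism A2 -> B}),
    exists f : {lrmorphism fp_alg -> B},
      [/\ forall x, f (fp_in1 x) = f1 x, forall y, f (fp_in2 y) = f2 y
        & forall g : {lrmorphism fp_alg -> B},
            (forall x, g (fp_in1 x) = f1 x) ->
            (forall y, g (fp_in2 y) = f2 y) -> g =1 f]
}.

Record functionals (R : realType) (A : algType R[i]) := Functionals {
  psi : {scalar A};
  phi : {scalar A};
  omega : {scalar A}
}.

Definition tracial (R : realType) (A : algType R[i]) (w : {scalar A}) : Prop :=
  forall x y : A, w (x * y) = w (y * x).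

Section Words.
Variables (R : realType) (A1 A2 : algType R[i]) (A : free_product A1 A2).

(** A sequence in the union of the two algebras is a sequence in their disjoint
    sum, which records the index [i_j] of each entry. *)
Definition fp_in (x : A1 + A2) : A :=
  match x with inl a => fp_in1 A a | inr b => fp_in2 A b end.

Definition other_side (x y : A1 + A2) : bool :=
  match x, y with inl _, inr _ | inr _, inl _ => true | _, _ => false end.

Definition alternating (s : seq (A1 + A2)) : bool :=
  (0 < size s)%N && sorted other_side s.

(** Since [other_side] is irreflexive, this forces [1 < size s]. *)
Definition cyclically_alternating (s : seq (A1 + A2)) : bool :=
  (0 < size s)%N && cycle other_side s.

Definition centered (f : {scalar A}) (s : seq (A1 + A2)) : bool :=
  all (fun x => f (fp_in x) == 0) s.

(** The relation [T = T1 ⊛ T2] defining the product of two triples; [T1] and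
    [T2] determine [T]. *)
Definition is_cyclic_product (T1 : functionals A1) (T2 : functionals A2)
    (T : functionals A) : Prop :=
  [/\ [/\ forall x, psi T (fp_in1 A x) = psi T1 x,
          forall x, phi T (fp_in1 A x) = phi T1 x
        & forall x, omega T (fp_in1 A x) = omega T1 x],
      [/\ forall y, psi T (fp_in2 A y) = psi T2 y,
          forall y, phi T (fp_in2 A y) = phi T2 y
        & forall y, omega T (fp_in2 A y) = omega T2 y],
      tracial (omega T),
      forall s, alternating s -> centered (psi T) s ->
        psi T (\prod_(x <- s) fp_in x) = 0 /\
        phi T (\prod_(x <- s) fp_in x) = \prod_(x <- s) phi T (fp_in x)
    & forall s, cyclically_alternating s -> centered (psi T) s ->
        omega T (\prod_(x <- s) fp_in x) = \prod_(x <- s) phi T (fp_in x)].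

End Words.

Definition cyclic_monotone_independent (R : realType) (A : algType R[i])
    (f w : {scalar A}) (B0 B : A -> Prop) : Prop :=
  forall (n : nat) (a b : nat -> A), (1 <= n)%N ->
    (forall j, (1 <= j <= n)%N -> B0 (a j)) ->
    (forall j, (j <= n)%N -> B (b j)) ->
    f (b 0%N * \prod_(1 <= j < n.+1) (a j * b j))
      = f (\prod_(1 <= j < n.+1) a j) * \prod_(0 <= j < n.+1) f (b j)
    /\
    w (b 0%N * \prod_(1 <= j < n.+1) (a j * b j))
      = w (\prod_(1 <= j < n.+1) a j)
        * \prod_(1 <= j < n) f (b j) * f (b n * b 0%N).

(* Main.v *)
Require Import Defs.
From HB Require Import structures.
From mathcomp Require Import all_boot all_order all_algebra.
From mathcomp Require Import reals complex.

Set Implicit Arguments.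
Unset Strict Implicit.
Unset Printing Implicit Defensive.

Import GRing.Theory.
Local Open Scope ring_scope.

(** Split every [b_j] as [phi b_j] times the unit plus a part on which [phi]
    vanishes. When the scalar part is taken, the unit disappears and the two
    neighbouring elements of the augmentation ideal multiply to one element of
    that ideal ([aug_mul_closed]). Expanding a word in this way gives the fully
    scalar term [phi b_1 ... phi b_n] times [a_1 ... a_n], plus words that
    alternate between the ideal and the kernel of [phi] on the second algebra
    and contain at least one letter of that kernel. The hypotheses
    [psi_1 = delta_1] and [psi_2 = phi_2] say that both sorts of letters are
    centered for [psi], so the defining rules of the product evaluate [phi] and
    [omega] on these words as products of values of [phi], and a letter of the
    kernel makes the product vanish.

    The expansion uses of the functional only that it kills the remaining words
    and is done once, in [collapse_word]. It is then applied to
    [x |-> phi (b_0 x)], and to [omega] after [b_0] has been moved cyclically to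
    the end of the word and merged with [b_n]. The only remaining words that are
    not cyclically alternating are those that begin and end in the ideal; by
    traciality their last letter can be merged into the first. *)

(** * Alternating words *)

Section Letters.
Variables (R : realType) (A1 A2 : algType R[i]).

Definition letters (s : seq (A1 * A2)) : seq (A1 + A2) :=
  flatten [seq [:: inl u.1; inr u.2] | u <- s].

Lemma path_letters (b : A2) (a : A1) (s : seq (A1 * A2)) :
  path (@other_side R A1 A2) (inr b) (letters s ++ [:: inl a]).
Proof. by elim: s b => //= u s IHs b; exact: IHs. Qed.

Lemma prod_letters (A : free_product A1 A2) (s : seq (A1 * A2)) :
  \prod_(x <- letters s) fp_in A x
    = \prod_(u <- s) (fp_in1 A u.1 * fp_in2 A u.2).
Proof.
elim: s => [|u s IHs]; first by rewrite !big_nil.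
by rewrite !big_cons IHs mulrA.
Qed.

End Letters.

(** * Expansion of a word in a functional *)

Section FreeProduct.
Variables (R : realType) (A1 A2 : algType R[i]) (A10 : augmentation A1).
Variable (A : free_product A1 A2).

Local Notation in1 := (fp_in1 A).
Local Notation in2 := (fp_in2 A).

Lemma aug_delta0 (a : A1) : a \in A10 -> aug_delta A10 a = 0.
Proof. by move=> aA; rewrite -[a]add0r -(scale0r 1) aug_deltaE. Qed.

Definition in_ideal (u : A1 * A2) : bool := u.1 \in A10.

(** The pairs of letters of the words that remain in the expansion. *)
Definition reduced (f : {scalar A}) (u : A1 * A2) : bool :=
  (u.1 \in A10) && (f (in2 u.2) == 0).

Lemma centering (f : {scalar A}) (b : A2) : f 1 = 1 ->
  exists2 c : A2, f (in2 c) = 0 & in2 b = (f (in2 b))%:A + in2 c.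
Proof.
move=> f1; exists (b - (f (in2 b))%:A).
  by rewrite raddfB /= linearZ rmorph1 raddfB /= scalarZ f1 mulr1 subrr.
by rewrite raddfB /= linearZ rmorph1 addrC subrK.
Qed.

(** The induction goes from left to right. The prefix [s] collects the letters
    already replaced by their centered parts; once it is nonempty, every term of
    the expansion is killed by [g]. A scalar part instead merges [a] with the
    next letter of the ideal and leaves [s] unchanged. *)
Lemma collapse_word_after (f g : {scalar A}) (s w : seq (A1 * A2))
    (a : A1) (b : A2) :
  f 1 = 1 ->
  (forall r, (0 < size r)%N -> all (reduced f) r ->
     g (\prod_(u <- r) (in1 u.1 * in2 u.2)) = 0) ->
  (forall r c, (0 < size r)%N -> all (reduced f) r -> c \in A10 ->
     g (\prod_(u <- r) (in1 u.1 * in2 u.2) * in1 c) = 0) ->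
  all (reduced f) s -> a \in A10 -> all in_ideal w ->
  g (\prod_(u <- s) (in1 u.1 * in2 u.2)
     * \prod_(u <- (a, b) :: w) (in1 u.1 * in2 u.2))
    = (nilp s)%:R * (\prod_(u <- (a, b) :: w) f (in2 u.2)
                     * g (\prod_(u <- (a, b) :: w) in1 u.1)).
Proof.
move=> f1 g0 g0a; elim: w s a b => [|[a' b'] w IHw] s a b sR aA wA.
  have [c fc eb] := centering b f1.
  have src : all (reduced f) (rcons s (a, c)).
    by rewrite all_rcons /reduced /= aA fc eqxx.
  have := g0 _ _ src; rewrite size_rcons => /(_ isT).
  rewrite -cats1 big_cat !big_seq1 /= => gc.
  rewrite {1}eb !mulrDr -scalerAr mulr1 -scalerAr raddfD /= gc addr0 scalarZ.
  case: (s) sR => [|u s'] sR /=.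
    by rewrite big_nil !mul1r.
  by rewrite g0a // mulr0 mul0r.
have [c fc eb] := centering b f1.
have src : all (reduced f) (rcons s (a, c)).
  by rewrite all_rcons /reduced /= aA fc eqxx.
move: wA => /= /andP[a'A wA].
have aaA : a * a' \in A10 by apply: aug_mul_closed.
have gc := IHw (rcons s (a, c)) a' b' src a'A wA.
rewrite /nilp size_rcons mul0r -cats1 big_cat big_seq1 /= -mulrA in gc.
have gs := IHw s (a * a') b' sR aaA wA.
rewrite !(big_cons _ _ (a, b)) /= {1}eb mulrDr mulrDl mulrDr raddfD /= gc addr0.
rewrite -scalerAr mulr1 -scalerAl -scalerAr scalarZ.
rewrite !big_cons /= in gs *; rewrite rmorphM in gs.
by rewrite !mulrA in gs *; rewrite gs !mulrA (mulrC (f (in2 b))).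
Qed.

(** Only the term in which every [b] is replaced by its scalar part survives:
    any other term is a reduced word, followed by a last letter of the ideal if
    the trailing [b] was replaced by its scalar part. *)
Lemma collapse_word (f g : {scalar A}) (w : seq (A1 * A2)) :
  f 1 = 1 ->
  (forall r, (0 < size r)%N -> all (reduced f) r ->
     g (\prod_(u <- r) (in1 u.1 * in2 u.2)) = 0) ->
  (forall r c, (0 < size r)%N -> all (reduced f) r -> c \in A10 ->
     g (\prod_(u <- r) (in1 u.1 * in2 u.2) * in1 c) = 0) ->
  (0 < size w)%N -> all in_ideal w ->
  g (\prod_(u <- w) (in1 u.1 * in2 u.2))
    = \prod_(u <- w) f (in2 u.2) * g (\prod_(u <- w) in1 u.1).
Proof.
move=> f1 g0 g0a; case: w => [//|[a b] w] _ /andP[aA wA].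
have := collapse_word_after b f1 g0 g0a (isT : all (reduced f) [::]) aA wA.
by rewrite big_nil !mul1r.
Qed.

End FreeProduct.

(** * Values on reduced words *)

Section CyclicProduct.
Variables (R : realType) (A1 A2 : algType R[i]) (A10 : augmentation A1).
Variables (T1 : functionals A1) (T2 : functionals A2).
Variables (A : free_product A1 A2) (T : functionals A).
Hypothesis phi2_unital : phi T2 1 = 1.
Hypothesis T_prod : is_cyclic_product T1 T2 T.
Hypothesis psi1_delta : forall x, psi T1 x = aug_delta A10 x.
Hypothesis psi2_phi2 : forall y, psi T2 y = phi T2 y.

Local Notation in1 := (fp_in1 A).
Local Notation in2 := (fp_in2 A).

Lemma phi_one : phi T 1 = 1.
Proof. by case: T_prod => _ [_ p2 _] _ _ _; rewrite -(rmorph1 in2) p2. Qed.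

Lemma psi_in1_ideal (a : A1) : a \in A10 -> psi T (in1 a) = 0.
Proof.
by case: T_prod => -[p1 _ _] _ _ _ _ aA; rewrite p1 psi1_delta aug_delta0.
Qed.

Lemma psi_in2 (b : A2) : psi T (in2 b) = phi T (in2 b).
Proof. by case: T_prod => _ [p2 f2 _] _ _ _; rewrite p2 f2 psi2_phi2. Qed.

Lemma centered_letters (s : seq (A1 * A2)) :
  all (reduced A10 (phi T)) s -> centered (psi T) (letters s).
Proof.
elim: s => //= u s IHs /andP[/andP[uA ub] /IHs cs].
by rewrite psi_in1_ideal // psi_in2 eqxx ub.
Qed.

Lemma prod_phi_letters_eq0 (s : seq (A1 * A2)) :
  (0 < size s)%N -> all (reduced A10 (phi T)) s ->
  \prod_(x <- letters s) phi T (fp_in A x) = 0.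
Proof.
case: s => //= u s _ /andP[/andP[_ /eqP ub] _].
by rewrite !big_cons /= ub mul0r mulr0.
Qed.

Lemma phi_ideal_right (b : A2) (a : A1) : a \in A10 ->
  phi T (in2 b * in1 a) = phi T (in2 b) * phi T (in1 a).
Proof.
move=> aA; have [c fc ->] := centering b phi_one.
have [_ _ _ alt _] := T_prod.
have cs : centered (psi T) [:: inr c; inl a].
  by rewrite /centered /= psi_in1_ideal // psi_in2 fc eqxx.
have [_] := alt [:: inr c; inl a] isT cs.
rewrite !big_cons !big_nil !mulr1 /= => ec.
rewrite mulrDl !raddfD /= ec mulrDl; congr (_ + _).
by rewrite -scalerAl mul1r !scalarZ phi_one mulr1.
Qed.

(** The first letter [b] need not be centered: its scalar part leaves the word
    [letters s ++ t], its centered part a word with one more centered letter,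
    and both alternate. The tail [t] allows for a word that ends in the ideal. *)
Lemma phi_reduced_tail (b : A2) (s : seq (A1 * A2)) (t : seq (A1 + A2)) :
  (0 < size s)%N -> all (reduced A10 (phi T)) s ->
  (forall c, path (@other_side R A1 A2) (inr c) (letters s ++ t)) ->
  centered (psi T) t ->
  phi T (in2 b * \prod_(x <- letters s ++ t) fp_in A x) = 0.
Proof.
move=> s0 sR altst ct; have [c fc ->] := centering b phi_one.
have [_ _ _ alt _] := T_prod.
have cst : centered (psi T) (letters s ++ t).
  by rewrite /centered all_cat; apply/andP; split=> //; exact: centered_letters.
have p0 : \prod_(x <- letters s ++ t) phi T (fp_in A x) = 0.
  by rewrite big_cat /= prod_phi_letters_eq0 ?mul0r.
have [|_ e1] := alt (letters s ++ t) _ cst.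
  rewrite /alternating (path_sorted (altst 0)) andbT.
  by case: (s) s0.
have [| |_ e2] := alt (inr c :: letters s ++ t).
- by rewrite /alternating /= altst.
- by rewrite /centered /= psi_in2 fc eqxx.
rewrite !big_cons /= fc mul0r in e2.
rewrite mulrDl -scalerAl mul1r raddfD /= scalarZ.
by rewrite e2 e1 p0 mulr0 addr0.
Qed.

Lemma omega_reduced (s : seq (A1 * A2)) :
  (0 < size s)%N -> all (reduced A10 (phi T)) s ->
  omega T (\prod_(u <- s) (in1 u.1 * in2 u.2)) = 0.
Proof.
move=> s0 sR; have [_ _ _ _ cyc] := T_prod.
rewrite -prod_letters cyc ?prod_phi_letters_eq0 ?centered_letters //.
case: s s0 {sR} => //= u s _.
by rewrite /cyclically_alternating /= -cats1 path_letters.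
Qed.

(** Such a word is not cyclically alternating, but cyclically its last letter
    stands next to its first, and merging the two gives a word that is. *)
Lemma omega_reduced_ideal (s : seq (A1 * A2)) (a : A1) :
  (0 < size s)%N -> all (reduced A10 (phi T)) s -> a \in A10 ->
  omega T (\prod_(u <- s) (in1 u.1 * in2 u.2) * in1 a) = 0.
Proof.
have [_ _ tr _ _] := T_prod.
case: s => // -[a' b'] s _ /andP[/andP[/= aA fb] sR] a'A.
have := @omega_reduced ((a * a', b') :: s) isT.
rewrite tr !big_cons /= rmorphM !mulrA; apply.
by apply/andP; split=> //; rewrite /reduced /= fb andbT aug_mul_closed.
Qed.

(** * Values on arbitrary words *)

Lemma phi_word (b : A2) (w : seq (A1 * A2)) :
  (0 < size w)%N -> all (in_ideal A10) w ->
  phi T (in2 b * \prod_(u <- w) (in1 u.1 * in2 u.2))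
    = phi T (\prod_(u <- w) in1 u.1)
      * (phi T (in2 b) * \prod_(u <- w) phi T (in2 u.2)).
Proof.
move=> w0 wA.
pose g : {scalar A} := (phi T \o (in2 b \*o idfun))%FUN.
have gr r : (0 < size r)%N -> all (reduced A10 (phi T)) r ->
    g (\prod_(u <- r) (in1 u.1 * in2 u.2)) = 0.
  move=> r0 rR; have := phi_reduced_tail b (t := [::]) r0 rR.
  rewrite cats0 prod_letters; apply=> // c.
  by have := path_letters c 0 r; rewrite cat_path => /andP[].
have gra r c : (0 < size r)%N -> all (reduced A10 (phi T)) r -> c \in A10 ->
    g (\prod_(u <- r) (in1 u.1 * in2 u.2) * in1 c) = 0.
  move=> r0 rR cA; have := phi_reduced_tail b (t := [:: inl c]) r0 rR.
  rewrite big_cat big_seq1 /= prod_letters; apply=> [d|].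
    exact: path_letters.
  by rewrite /centered /= psi_in1_ideal ?eqxx.
have := collapse_word phi_one gr gra w0 wA; rewrite /g /= => ->.
have iA : \prod_(u <- w) u.1 \in A10.
  case: w w0 wA {gr gra} => // u w _; elim: w u => [|v w IHw] u /andP[uA wA].
    by rewrite big_seq1.
  by rewrite big_cons; apply: aug_mul_closed => //; exact: IHw.
by rewrite -rmorph_prod phi_ideal_right // mulrCA mulrA mulrC.
Qed.

Lemma omega_word (w : seq (A1 * A2)) :
  (0 < size w)%N -> all (in_ideal A10) w ->
  omega T (\prod_(u <- w) (in1 u.1 * in2 u.2))
    = \prod_(u <- w) phi T (in2 u.2) * omega T (\prod_(u <- w) in1 u.1).
Proof.
exact: (collapse_word phi_one omega_reduced omega_reduced_ideal).
Qed.

End CyclicProduct.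

Theorem proposition3p2p2 (R : realType) (A1 A2 : algType R[i])
    (A10 : augmentation A1) (A20 : augmentation A2)
    (T1 : functionals A1) (T2 : functionals A2)
    (psi1_unital : psi T1 1 = 1) (phi1_unital : phi T1 1 = 1)
    (psi2_unital : psi T2 1 = 1) (phi2_unital : phi T2 1 = 1)
    (omega1_tracial : tracial (omega T1)) (omega2_tracial : tracial (omega T2))
    (omega_one : omega T1 1 = omega T2 1)
    (A : free_product A1 A2) (T : functionals A)
    (T_prod : is_cyclic_product T1 T2 T)
    (psi1_delta : forall x, psi T1 x = aug_delta A10 x)
    (psi2_phi2 : forall y, psi T2 y = phi T2 y) :
  (forall (n : nat) (a : nat -> A1) (b : nat -> A2), (1 <= n)%N ->
     (forall j, (1 <= j <= n)%N -> a j \in A10) ->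
     phi T (fp_in2 A (b 0%N)
            * \prod_(1 <= j < n.+1) (fp_in1 A (a j) * fp_in2 A (b j)))
       = phi T (\prod_(1 <= j < n.+1) fp_in1 A (a j))
         * \prod_(0 <= j < n.+1) phi T (fp_in2 A (b j))
     /\
     omega T (fp_in2 A (b 0%N)
              * \prod_(1 <= j < n.+1) (fp_in1 A (a j) * fp_in2 A (b j)))
       = omega T (\prod_(1 <= j < n.+1) fp_in1 A (a j))
         * \prod_(1 <= j < n) phi T (fp_in2 A (b j))
         * phi T (fp_in2 A (b n) * fp_in2 A (b 0%N)))
  /\
  cyclic_monotone_independent (phi T) (omega T)
    (fun x => exists2 a, a \in A10 & x = fp_in1 A a)
    (fun y => exists b, y = fp_in2 A b).
Proof.
have words (n : nat) (a : nat -> A1) (b : nat -> A2) : (1 <= n)%N ->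
    (forall j, (1 <= j <= n)%N -> a j \in A10) ->
    let w := [seq (a j, b j) | j <- index_iota 1 n.+1] in
    (0 < size w)%N /\ all (in_ideal A10) w.
  move=> n0 aA /=; rewrite size_map size_iota subn1; split=> //.
  by apply/allP => u /mapP[j]; rewrite mem_index_iota ltnS => /aA ? ->.
have main (n : nat) (a : nat -> A1) (b : nat -> A2) : (1 <= n)%N ->
    (forall j, (1 <= j <= n)%N -> a j \in A10) ->
    phi T (fp_in2 A (b 0%N)
           * \prod_(1 <= j < n.+1) (fp_in1 A (a j) * fp_in2 A (b j)))
      = phi T (\prod_(1 <= j < n.+1) fp_in1 A (a j))
        * \prod_(0 <= j < n.+1) phi T (fp_in2 A (b j))
    /\
    omega T (fp_in2 A (b 0%N)
             * \prod_(1 <= j < n.+1) (fp_in1 A (a j) * fp_in2 A (b j)))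
      = omega T (\prod_(1 <= j < n.+1) fp_in1 A (a j))
        * \prod_(1 <= j < n) phi T (fp_in2 A (b j))
        * phi T (fp_in2 A (b n) * fp_in2 A (b 0%N)).
  move=> n0 aA; split.
    have [w0 wA] := words n a b n0 aA.
    have := phi_word phi2_unital T_prod psi1_delta psi2_phi2 (b 0%N) w0 wA.
    by rewrite !big_map /= => ->; rewrite [\prod_(0 <= j < n.+1) _]big_ltn.
  have [_ _ tr _ _] := T_prod.
  (* Cyclically [b 0] follows [b n], so the two merge into one letter. *)
  pose b' j := if j == n then b n * b 0%N else b j.
  have b'E j : (1 <= j < n)%N -> b' j = b j.
    by move=> /andP[_ jn]; rewrite /b' ltn_eqF.
  have wordE : \prod_(1 <= j < n.+1) (fp_in1 A (a j) * fp_in2 A (b j))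
        * fp_in2 A (b 0%N)
      = \prod_(1 <= j < n.+1) (fp_in1 A (a j) * fp_in2 A (b' j)).
    rewrite !(big_nat_recr n) //= -!mulrA -rmorphM /b' eqxx; congr (_ * _).
    by apply: eq_big_nat => j /b'E; rewrite /b' => ->.
  have phiE : \prod_(1 <= j < n.+1) phi T (fp_in2 A (b' j))
      = \prod_(1 <= j < n) phi T (fp_in2 A (b j))
        * phi T (fp_in2 A (b n) * fp_in2 A (b 0%N)).
    rewrite (big_nat_recr n) //= -rmorphM /b' eqxx; congr (_ * _).
    by apply: eq_big_nat => j /b'E; rewrite /b' => ->.
  have [w0 wA] := words n a b' n0 aA.
  have := omega_word phi2_unital T_prod psi1_delta psi2_phi2 w0 wA.
  by rewrite tr wordE !big_map /= phiE => ->; rewrite mulrC mulrA.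
split=> // n a b n0 aP bP.
(* The implications make the choice below total; out of range any value does. *)
have aex j : exists x, (1 <= j <= n)%N ==> (x \in A10) && (a j == fp_in1 A x).
  case: (boolP (1 <= j <= n)%N) => [/aP[x xA ->]|_]; last by exists 0.
  by exists x; rewrite xA eqxx.
have bex j : exists y, (j <= n)%N ==> (b j == fp_in2 A y).
  case: (boolP (j <= n)%N) => [/bP[y ->]|_]; last by exists 0.
  by exists y; rewrite eqxx.
pose a' j := xchoose (aex j); pose b' j := xchoose (bex j).
have a'P j : (1 <= j <= n)%N -> a' j \in A10 /\ a j = fp_in1 A (a' j).
  by move=> jn; have := xchooseP (aex j) => /implyP /(_ jn) /andP[? /eqP].
have b'P j : (j <= n)%N -> b j = fp_in2 A (b' j).
  by move=> jn; have := xchooseP (bex j) => /implyP /(_ jn) /eqP.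
have a'A j : (1 <= j <= n)%N -> a' j \in A10 by case/a'P.
have aE : \prod_(1 <= j < n.+1) a j = \prod_(1 <= j < n.+1) fp_in1 A (a' j).
  by apply: eq_big_nat => j /a'P[].
have abE : \prod_(1 <= j < n.+1) (a j * b j)
    = \prod_(1 <= j < n.+1) (fp_in1 A (a' j) * fp_in2 A (b' j)).
  apply: eq_big_nat => j jn; have [_ ->] := a'P j jn.
  by rewrite b'P //; case/andP: jn.
have fE : \prod_(0 <= j < n.+1) phi T (b j)
    = \prod_(0 <= j < n.+1) phi T (fp_in2 A (b' j)).
  by apply: eq_big_nat => j jn; rewrite b'P.
have wE : \prod_(1 <= j < n) phi T (b j)
    = \prod_(1 <= j < n) phi T (fp_in2 A (b' j)).
  by apply: eq_big_nat => j /andP[_ jn]; rewrite b'P // ltnW.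
by rewrite aE abE fE wE !b'P //; exact: main.
Qed.
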